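(* Let $M$ be a three-dimensional compact manifold with Riemannian metric $g$. Consider, in local coordinates $(x^1,x^2,x^3)$, the second-order differential operator given by the right-hand side of the system $$\begin{cases}\dfrac{\partial g_{ij}}{\partial t}=g^{kl}\dfrac{\partial^2 g_{ij}}{\partial x^k\partial x^l}+\dfrac12H_{ikl}H_j{}^{kl}+2F_i{}^kF_{jk},\\[2mm]\dfrac{\partial A_i}{\partial t}=g^{kl}\dfrac{\partial^2A_i}{\partial x^k\partial x^l},\\[2mm]\dfrac{\partial B_{ij}}{\partial t}=g^{kl}\dfrac{\partial^2B_{ij}}{\partial x^k\partial x^l}\end{cases}$$ for a Riemannian metric $g_{ij}$, a one-form $A_i$ and a two-form $B_{ij}$ on $M$, regarded as a system for the twelve unknown functions $u=(g_{11},g_{12},g_{13},g_{22},g_{23},g_{33},A_1,A_2,A_3,B_{12},B_{13},B_{23})$. This operator is uniformly elliptic.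
   Context: $F=dA$, $H=dB$, i.e. $F_{ij}=\partial_iA_j-\partial_jA_i$ and $H_{ijk}=\partial_iB_{jk}+\partial_jB_{ki}+\partial_kB_{ij}$; indices are raised with $g$ and repeated indices are summed. The system has the form $\partial_tu_i=\sum_{j,k,l}a_{ikjl}\,\dfrac{\partial^2u_j}{\partial x^k\partial x^l}+(\text{lower order terms})$ with $i,j\in\{1,\dots,12\}$, $k,l\in\{1,2,3\}$. Uniform ellipticity means that there is a constant $\lambda>0$ such that $\sum_{i,j,k,l}a_{ikjl}\,\xi^i_k\xi^j_l\ge\lambda\sum_{i,k}|\xi^i_k|^2$ for all real $\xi=(\xi^i_k)\in\mathbb{R}^{12\times3}$ and all points; the constant is taken over the compact manifold $M$, covered by finitely many compact subsets of coordinate charts in which the coefficients $a_{ikjl}$ are expressed. *)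

(* Defs.v *)
From HB Require Import structures.
From mathcomp Require Import all_boot all_order all_algebra.
From mathcomp Require Import all_classical all_reals all_analysis.
Import Order.TTheory GRing.Theory Num.Theory.
Import numFieldNormedType.Exports.

Set Implicit Arguments.
Unset Strict Implicit.
Unset Printing Implicit Defensive.

Local Open Scope classical_set_scope.
Local Open Scope ring_scope.

Definition partial {R : realType} {n : nat} (k : 'I_n) (f : 'rV[R]_n -> R)
    : 'rV[R]_n -> R :=
  fun x => 'D_(delta_mx 0 k) f x.

(* C^m on the open set U; the functions are total, but only their values on U
   matter. *)
Fixpoint Ck {R : realType} {n : nat} (U : set 'rV[R]_n) (m : nat)
    (f : 'rV[R]_n -> R) : Prop :=
  (forall x, U x -> {for x, continuous f}) /\
  match m with
  | 0 => True
  | m'.+1 => forall k : 'I_n,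
      (forall x, U x -> derivable f x (delta_mx 0 k)) /\ Ck U m' (partial k f)
  end.

Definition smooth {R : realType} {n : nat} (U : set 'rV[R]_n)
    (f : 'rV[R]_n -> R) : Prop :=
  forall m, Ck U m f.

(** Smooth manifolds *)

(* [coord] and [param] are total functions with junk values outside [dom] and
   [coord @` dom] respectively. *)
Record chart (R : realType) (M : topologicalType) (n : nat) := Chart {
  dom : set M;
  coord : M -> 'rV[R]_n;
  param : 'rV[R]_n -> M;
  dom_open : open dom;
  image_open : open (coord @` dom);
  coordK : forall p, dom p -> param (coord p) = p;
  coord_continuous : {within dom, continuous coord};
  param_continuous : {within coord @` dom, continuous param}
}.

Definition transition {R : realType} {M : topologicalType} {n : nat}
    (e e' : chart R M n) : 'rV[R]_n -> 'rV[R]_n :=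
  fun x => coord e' (param e x).

(* Not assumed maximal.  Second countability is not required, as it is
   automatic for compact M. *)
Definition smooth_atlas {R : realType} {M : topologicalType} {n : nat}
    (C : set (chart R M n)) : Prop :=
  (forall p : M, exists2 e, C e & dom e p) /\
  (forall e e', C e -> C e' -> forall a : 'I_n,
     smooth (coord e @` (dom e `&` dom e')) (fun x => transition e e' x 0 a)).

(** Tensor fields, given by their components in every chart of the atlas.
    With y = transition e e' and J = 'J y x, the library's row-vector
    convention gives J i a = \partial y^a / \partial x^i, so that J T' J^T has
    entries \sum_(a, b) \partial_i y^a \partial_j y^b T'_ab. *)

Definition covariant2_tensor {R : realType} {M : topologicalType} {n : nat}
    (C : set (chart R M n)) (T : chart R M n -> 'rV[R]_n -> 'M[R]_n) : Prop :=
  (forall e, C e -> forall i j,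
     smooth (coord e @` dom e) (fun x => T e x i j)) /\
  (forall e e', C e -> C e' -> forall p, dom e p -> dom e' p ->
     let J := 'J (transition e e') (coord e p) in
     T e (coord e p) = J *m T e' (coord e' p) *m J^T).

Definition posdef {R : realType} {n : nat} (g : 'M[R]_n) : Prop :=
  forall v : 'rV[R]_n, v != 0 -> 0 < (v *m g *m v^T) 0 0.

Definition riemannian_metric {R : realType} {M : topologicalType} {n : nat}
    (C : set (chart R M n)) (g : chart R M n -> 'rV[R]_n -> 'M[R]_n) : Prop :=
  covariant2_tensor C g /\
  forall e, C e -> forall x, (coord e @` dom e) x ->
    (g e x)^T = g e x /\ posdef (g e x).

Definition one_form {R : realType} {M : topologicalType} {n : nat}
    (C : set (chart R M n)) (A : chart R M n -> 'rV[R]_n -> 'rV[R]_n) : Prop :=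
  (forall e, C e -> forall i,
     smooth (coord e @` dom e) (fun x => A e x 0 i)) /\
  (forall e e', C e -> C e' -> forall p, dom e p -> dom e' p ->
     A e (coord e p) =
     A e' (coord e' p) *m ('J (transition e e') (coord e p))^T).

Definition two_form {R : realType} {M : topologicalType} {n : nat}
    (C : set (chart R M n)) (B : chart R M n -> 'rV[R]_n -> 'M[R]_n) : Prop :=
  covariant2_tensor C B /\
  forall e, C e -> forall x, (coord e @` dom e) x -> (B e x)^T = - B e x.

(** Uniform ellipticity of second-order quasilinear operators *)

Definition coefficients (R : realType) (n N : nat) : Type :=
  'I_N -> 'I_n -> 'I_N -> 'I_n -> R.

(* P has the form
     (P u)_i = \sum_(j,k,l) a_ikjl(x, u) \partial_k \partial_l u_j
               + b_i(x, u, \partial u)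
   on functions with values in D.  Since mixed partial derivatives commute,
   only the part of a that is symmetric in k, l is determined by P; it is
   the one required here. *)
Definition leading_coefficients {R : realType} {n N : nat} (D : set 'rV[R]_N)
    (P : ('rV[R]_n -> 'rV[R]_N) -> 'rV[R]_n -> 'rV[R]_N)
    (a : 'rV[R]_n -> 'rV[R]_N -> coefficients R n N) : Prop :=
  (forall x v i k j l, a x v i k j l = a x v i l j k) /\
  exists b : 'rV[R]_n -> 'rV[R]_N -> 'M[R]_(n, N) -> 'rV[R]_N,
    forall (U : set 'rV[R]_n) (u : 'rV[R]_n -> 'rV[R]_N),
      open U ->
      (forall j, Ck U 2 (fun y => u y 0 j)) ->
      (forall x, U x -> D (u x)) ->
      forall x, U x -> forall i : 'I_N,
        P u x 0 i =
          \sum_j \sum_k \sum_l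
            a x (u x) i k j l * partial k (partial l (fun y => u y 0 j)) x
          + b x (u x) (\matrix_(k, j) partial k (fun y => u y 0 j) x) 0 i.

Definition compact_chart_cover {R : realType} {M : topologicalType} {n : nat}
    (C : set (chart R M n)) (m : nat) (e : 'I_m -> chart R M n)
    (K : 'I_m -> set M) : Prop :=
  (forall s, [/\ C (e s), compact (K s) & K s `<=` dom (e s)]) /\
  (forall p : M, exists s, K s p).

(* The operator P is expressed by the same formula in all charts; its
   coefficients are evaluated at the section u, where [u e] is the expression
   of u in the chart e.  The constant depends on the cover, since the
   coefficients are not invariant under changes of coordinates. *)
Definition uniformly_elliptic {R : realType} {M : topologicalType} {n N : nat}
    (C : set (chart R M n)) (D : set 'rV[R]_N)
    (P : ('rV[R]_n -> 'rV[R]_N) -> 'rV[R]_n -> 'rV[R]_N)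
    (u : chart R M n -> 'rV[R]_n -> 'rV[R]_N) : Prop :=
  exists2 a, leading_coefficients D P a &
    (exists m (e : 'I_m -> chart R M n) (K : 'I_m -> set M),
       compact_chart_cover C e K) /\
    (forall m (e : 'I_m -> chart R M n) (K : 'I_m -> set M),
       compact_chart_cover C e K ->
       exists2 lambda : R, 0 < lambda &
         forall s p, K s p -> forall xi : 'M[R]_(N, n),
           let x := coord (e s) p in
           lambda * (\sum_i \sum_k xi i k ^+ 2) <=
           \sum_i \sum_k \sum_j \sum_l
             a x (u (e s) x) i k j l * xi i k * xi j l).

(** The system in the unknowns
    u = (g11, g12, g13, g22, g23, g33, A1, A2, A3, B12, B13, B23);
    coordinate indices 1, 2, 3 are represented by 0, 1, 2. *)

Definition c1 : 'I_3 := @Ordinal 3 0 isT.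
Definition c2 : 'I_3 := @Ordinal 3 1 isT.
Definition c3 : 'I_3 := @Ordinal 3 2 isT.

Definition pack {R : realType} (g : 'M[R]_3) (A : 'rV[R]_3) (B : 'M[R]_3)
    : 'rV[R]_12 :=
  \row_(i < 12) nth 0
    [:: g c1 c1; g c1 c2; g c1 c3; g c2 c2; g c2 c3; g c3 c3;
        A 0 c1; A 0 c2; A 0 c3;
        B c1 c2; B c1 c3; B c2 c3] i.

Definition entry {R : realType} (v : 'rV[R]_12) (m : nat) : R := v 0 (inord m).

Definition metric_of {R : realType} (v : 'rV[R]_12) : 'M[R]_3 :=
  \matrix_(i, j) nth 0 (nth [::]
    [:: [:: entry v 0; entry v 1; entry v 2];
        [:: entry v 1; entry v 3; entry v 4];
        [:: entry v 2; entry v 4; entry v 5]] i) j.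

Definition one_form_of {R : realType} (v : 'rV[R]_12) : 'rV[R]_3 :=
  \row_i nth 0 [:: entry v 6; entry v 7; entry v 8] i.

Definition two_form_of {R : realType} (v : 'rV[R]_12) : 'M[R]_3 :=
  \matrix_(i, j) nth 0 (nth [::]
    [:: [:: 0; entry v 9; entry v 10];
        [:: - entry v 9; 0; entry v 11];
        [:: - entry v 10; - entry v 11; 0]] i) j.

Definition admissible {R : realType} : set 'rV[R]_12 :=
  [set v | posdef (metric_of v)].

Definition dA {R : realType} (A : 'rV[R]_3 -> 'rV[R]_3) (x : 'rV[R]_3)
    (i j : 'I_3) : R :=
  partial i (fun y => A y 0 j) x - partial j (fun y => A y 0 i) x.

Definition dB {R : realType} (B : 'rV[R]_3 -> 'M[R]_3) (x : 'rV[R]_3)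
    (i j k : 'I_3) : R :=
  partial i (fun y => B y j k) x + partial j (fun y => B y k i) x
  + partial k (fun y => B y i j) x.

Definition trace_hessian {R : realType} (ginv : 'M[R]_3)
    (f : 'rV[R]_3 -> R) (x : 'rV[R]_3) : R :=
  \sum_k \sum_l ginv k l * partial k (partial l f) x.

Definition flow_operator {R : realType} (u : 'rV[R]_3 -> 'rV[R]_12)
    (x : 'rV[R]_3) : 'rV[R]_12 :=
  let g y := metric_of (u y) in
  let A y := one_form_of (u y) in
  let B y := two_form_of (u y) in
  let ginv := invmx (g x) in
  let F := dA A x in
  let H := dB B x in
  pack
    (\matrix_(i, j)
       (trace_hessian ginv (fun y => g y i j) x
        + 2^-1 * (\sum_k \sum_l \sum_p \sum_q
                    H i k l * (ginv k p * ginv l q * H j p q))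
        + 2 * (\sum_k \sum_p (F i p * ginv p k) * F j k)))
    (\row_i trace_hessian ginv (fun y => A y 0 i) x)
    (\matrix_(i, j) trace_hessian ginv (fun y => B y i j) x).

(* Main.v *)
From Pilot Require Import Defs.
From mathcomp Require Import all_boot all_order all_algebra.
From mathcomp Require Import all_classical all_reals all_analysis.
From mathcomp Require Import ring lra.
Import numFieldNormedType.Exports.
Import Order.TTheory GRing.Theory Num.Theory.
Import Pilot.Defs.

(** Each of the twelve equations has the same principal part g^(kl) d_k d_l,
    acting on its own unknown: the quadratic terms in F = dA and H = dB only
    contain first derivatives of A and B.  The leading coefficients therefore
    form the block scalar symbol delta_ij g^(kl) ([flow_symbol]), and the
    quadratic form to be bounded below is the sum over the twelve rows xi_i of
    xi_i g^(-1) xi_i^T.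

    A lower bound on g^(-1) follows from an upper bound on g: if
    w g w^T <= c |w|^2, then w g^(-1) w^T >= |w|^2 / c
    ([invmx_quad_form_ge]).  The form of g is at most 3 b |w|^2 as soon as all
    entries of g are at most b in absolute value ([quad_form_le]).  In one
    chart, the entries of g are continuous, hence bounded on each compact
    piece of a chart cover ([compact_chart_bounded]); such a cover has
    finitely many pieces, so one b serves all of them, and 1 / (3 b) is an
    ellipticity constant.  Covers of this kind exist because a compact
    Hausdorff space is regular ([compact_chart_cover_exists]). *)

Set Implicit Arguments.
Unset Strict Implicit.
Unset Printing Implicit Defensive.

Local Open Scope classical_set_scope.
Local Open Scope ring_scope.

(** * Compactness in charts *)

(** The near-covering form of compactness is applied to the filter of all
    conditions that hold for every sufficiently large finite sequence. *)
Lemma compact_finite_nbhs_cover (T : topologicalType) (K : set T)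
    (V : T -> set T) :
  compact K -> (forall x, K x -> nbhs x (V x)) ->
  exists s : seq T, forall y, K y -> exists2 x, x \in s & V x y.
Proof.
move=> /compact_near_coveringP cK nV.
pose F : set_system (seq T) :=
  [set Q | exists s0 : seq T, forall s : seq T, {subset s0 <= s} -> Q s].
have FF : Filter F.
  split; first by exists [::].
  - move=> Q1 Q2 [s1 h1] [s2 h2]; exists (s1 ++ s2) => s hs; split.
      by apply: h1 => y ys; apply: hs; rewrite mem_cat ys.
    by apply: h2 => y ys; apply: hs; rewrite mem_cat ys orbT.
  - by move=> Q1 Q2 Q12 [s h]; exists s => t /h /Q12.
have [x Kx|s0 h] := cK _ F (fun s y => exists2 x, x \in s & V x y) FF.
  exists (V x, [set s : seq T | x \in s]) => /=.
    split; first exact: nV.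
    by exists [:: x] => s; apply; rewrite mem_head.
  by move=> [y s] /= [Vxy xs]; exists x.
by exists s0; exact: h.
Qed.

(** By regularity every point has a neighborhood whose closure lies in the
    domain of a chart around it; these closures are compact, and finitely
    many of them cover. *)
Lemma compact_chart_cover_exists (R : realType) (M : topologicalType) (n : nat)
    (C : set (chart R M n)) :
  hausdorff_space M -> compact [set: M] ->
  (forall p : M, exists2 e, C e & dom e p) ->
  exists m (e : 'I_m -> chart R M n) (K : 'I_m -> set M),
    compact_chart_cover C e K.
Proof.
move=> hM cM cov.
have loc (p : M) : exists eK : chart R M n * set M,
    [/\ C eK.1, compact eK.2, eK.2 `<=` dom eK.1 & nbhs p eK.2].
  have [e Ce ep] := cov p.
  have Np : nbhs p (dom e).
    by apply: open_nbhs_nbhs; split; [exact: dom_open|].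
  have [V nV clV] := @compact_regular M p setT hM cM (filterT) _ Np.
  exists (e, closure V); split => //=.
    exact: (subclosed_compact (@closed_closure _ V) cM).
  by apply: filterS nV; exact: subset_closure.
pose eK p := projT1 (cid (loc p)).
have [s hs] := @compact_finite_nbhs_cover M setT (fun p => (eK p).2) cM
  (fun p _ => let: And4 _ _ _ h := projT2 (cid (loc p)) in h).
exists (size s), (fun i => (eK (tnth (in_tuple s) i)).1),
  (fun i => (eK (tnth (in_tuple s) i)).2); split.
  by move=> i; rewrite /eK; case: (cid _) => -[e K] /= [].
move=> p; have [q qs Kp] := hs p I.
have /tnthP[i qi] : q \in in_tuple s by [].
by exists i; rewrite -qi.
Qed.

(** The chart domain is open, so continuity of the coordinates within it is
    continuity at each of its points, and f composed with them has a compact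
    image. *)
Lemma compact_chart_bounded (R : realType) (M : topologicalType) (n : nat)
    (e : chart R M n) (K : set M) (f : 'rV[R]_n -> R) :
  compact K -> K `<=` dom e ->
  (forall x, (coord e @` dom e) x -> {for x, continuous f}) ->
  exists2 c, 0 <= c & forall p, K p -> `|f (coord e p)| <= c.
Proof.
move=> cK Kd cf.
have cc : compact ((f \o coord e) @` K).
  apply: continuous_compact => //.
  apply: (@continuous_subspaceW _ _ _ (dom e)) => //.
  rewrite continuous_open_subspace; last exact: dom_open.
  move=> p pd; apply: continuous_comp.
    have := @coord_continuous _ _ _ e.
    by rewrite continuous_open_subspace; [exact|exact: dom_open].
  by apply: cf; exists p => //; exact/set_mem.
have [N [Nr hN]] := compact_bounded cc.
exists (`|N| + 1) => [|p Kp]; first by rewrite addr_ge0.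
by apply: (hN (`|N| + 1)); [rewrite (le_lt_trans (ler_norm N)) ?ltrDl|exists p].
Qed.

(** * Quadratic forms of matrices *)

Lemma posdef_unitmx (R : realType) (n : nat) (g : 'M[R]_n) :
  posdef g -> g \in unitmx.
Proof.
move=> pg; rewrite -row_free_unit; apply: inj_row_free => v vg.
apply/eqP; apply: contraT => /pg.
by rewrite vg mul0mx mxE ltxx.
Qed.

(** Termwise, w_i g_ij w_j <= c |w_i w_j| <= c (w_i^2 + w_j^2) / 2. *)
Lemma quad_form_le (R : realType) (n : nat) (g : 'M[R]_n) (c : R) :
  (forall i j, `|g i j| <= c) ->
  forall w : 'rV_n, (w *m g *m w^T) 0 0 <= c * n%:R * \sum_k w 0 k ^+ 2.
Proof.
move=> gc w.
have -> : (w *m g *m w^T) 0 0 = \sum_j \sum_i w 0 i * g i j * w 0 j.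
  by rewrite mxE; apply: eq_bigr => j _; rewrite !mxE mulr_suml.
have -> : c * n%:R * (\sum_k w 0 k ^+ 2) =
    \sum_(j < n) \sum_(i < n) c * ((w 0 i ^+ 2 + w 0 j ^+ 2) / 2).
  under [RHS]eq_bigr do
    rewrite -mulr_sumr -mulr_suml big_split /= sumr_const card_ord.
  rewrite -mulr_sumr -mulr_suml big_split /= sumr_const card_ord -sumrMnl.
  rewrite -mulr_natr sumrMnl -mulr_natr; by field.
apply: ler_sum => j _; apply: ler_sum => i _.
have := gc i j; rewrite ler_norml => /andP[g1 g2].
have := sqr_ge0 (w 0 i + w 0 j); have := sqr_ge0 (w 0 i - w 0 j).
nra.
Qed.

(** This direct bound replaces a spectral argument.  The form of g is
    nonnegative at z = w g^(-1) - t w, which reads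
    0 <= w g^(-1) w^T - 2 t |w|^2 + t^2 w g w^T, and t = 1 / c is the choice
    that makes the resulting lower bound for w g^(-1) w^T largest. *)
Lemma invmx_quad_form_ge (R : realType) (n : nat) (g : 'M[R]_n) (c : R)
    (w : 'rV[R]_n) :
  g^T = g -> posdef g -> 0 < c ->
  (w *m g *m w^T) 0 0 <= c * \sum_k w 0 k ^+ 2 ->
  c^-1 * (\sum_k w 0 k ^+ 2) <= (w *m invmx g *m w^T) 0 0.
Proof.
move=> gs pg c0 hc; have ug := posdef_unitmx pg.
have nw : (w *m w^T) 0 0 = \sum_k w 0 k ^+ 2.
  by rewrite mxE; apply: eq_bigr => k _; rewrite mxE expr2.
pose z := w *m invmx g - c^-1 *: w.
have z0 : 0 <= (z *m g *m z^T) 0 0.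
  have [->|/pg/ltW//] := eqVneq z 0.
  by rewrite !mul0mx mxE.
have zE : z *m g *m z^T = w *m invmx g *m w^T - (2 * c^-1) *: (w *m w^T)
    + (c^-1 ^+ 2) *: (w *m g *m w^T).
  rewrite /z [(_ - _)^T]linearB /= [(_ *: _)^T]linearZ /= trmx_mul trmx_inv gs.
  rewrite mulmxBl mulmxKV // -scalemxAl mulmxBl !mulmxBr.
  rewrite -!scalemxAl -!scalemxAr.
  rewrite !mulmxA mulmxK // scalerA -expr2.
  by rewrite mulr_natl mulr2n scalerDl opprB opprD !addrA [RHS]addrAC.
have ent (X Y Z : 'M[R]_1) a b :
    (X - a *: Y + b *: Z) 0 0 = X 0 0 - a * Y 0 0 + b * Z 0 0.
  by rewrite !mxE.
move: z0; rewrite zE ent nw => z0.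
have ic0 : 0 < c^-1 by rewrite invr_gt0.
have := ler_wpM2l (ltW (exprn_gt0 2 ic0)) hc.
rewrite mulrA expr2 -[_ * _ * c]mulrA mulVf ?gt_eqF // mulr1 => hc'.
rewrite expr2 in z0; lra.
Qed.

(** * The packed unknowns and the symbol *)

Definition flow_symbol {R : realType} (x : 'rV[R]_3) (v : 'rV[R]_12) :
    coefficients R 3 12 :=
  fun i k j l => (i == j)%:R * invmx (metric_of v) k l.

Lemma flow_symbol_sum (R : realType) (x : 'rV[R]_3) (v : 'rV[R]_12)
    (i : 'I_12) (h : 'I_3 -> 'I_3 -> 'I_12 -> R) :
  \sum_j \sum_k \sum_l flow_symbol x v i k j l * h k l j =
  \sum_k \sum_l invmx (metric_of v) k l * h k l i.
Proof.
rewrite (bigD1 i) //= [X in _ + X]big1 => [|j /negbTE ji].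
  by rewrite addr0; do 2!apply: eq_bigr => ? _; rewrite /flow_symbol eqxx mul1r.
by do 2!rewrite big1 => // ? _; rewrite /flow_symbol eq_sym ji !mul0r.
Qed.

Lemma metric_of_sym (R : realType) (v : 'rV[R]_12) :
  (metric_of v)^T = metric_of v.
Proof.
by apply/matrixP => -[[|[|[|//]]] ?] -[[|[|[|//]]] ?]; rewrite !mxE.
Qed.

Lemma metric_of_pack (R : realType) (g : 'M[R]_3) (A : 'rV[R]_3) (B : 'M[R]_3) :
  g^T = g -> metric_of (pack g A B) = g.
Proof.
move=> gs; have gsE i j : g i j = g j i by rewrite -{1}gs mxE.
by apply/matrixP => -[[|[|[|//]]] ?] -[[|[|[|//]]] ?];
  rewrite !mxE /= /entry mxE inordK //=;
  (by congr (g _ _); apply/val_inj)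
  || (by rewrite gsE; congr (g _ _); apply/val_inj).
Qed.

(** [pack] reads the two-form only above the diagonal, where [two_form_of] has
    no minus sign; this is why T can be an arbitrary functional. *)
Lemma pack_componentwise (R : realType) (X : Type) (T : (X -> R) -> R)
    (u : X -> 'rV[R]_12) (i : 'I_12) :
  pack (\matrix_(k, l) T (fun y => metric_of (u y) k l))
       (\row_k T (fun y => one_form_of (u y) 0 k))
       (\matrix_(k, l) T (fun y => two_form_of (u y) k l)) 0 i =
  T (fun y => u y 0 i).
Proof.
rewrite mxE.
case: i => -[|[|[|[|[|[|[|[|[|[|[|[|//]]]]]]]]]]]] hi; rewrite !mxE /=;
  congr T; apply/funext => y; rewrite !mxE /= /entry; congr (u y 0 _);
  by apply/val_inj; rewrite /= inordK.
Qed.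

Lemma pack_metricD (R : realType) (G L : 'M[R]_3) (A : 'rV[R]_3) (B : 'M[R]_3)
    (i : 'I_12) :
  pack (\matrix_(k, l) (G k l + L k l)) A B 0 i
  = pack G A B 0 i + pack L 0 0 0 i.
Proof.
rewrite !mxE.
by case: i => -[|[|[|[|[|[|[|[|[|[|[|[|//]]]]]]]]]]]] hi;
  rewrite /= ?mxE ?addr0.
Qed.

(** * Lower order terms *)

(** The layout is the one in which [leading_coefficients] passes the first
    derivatives to the lower order part of an operator. *)
Definition jet {R : realType} (u : 'rV[R]_3 -> 'rV[R]_12) (x : 'rV[R]_3)
    : 'M[R]_(3, 12) :=
  \matrix_(k, j) partial k (fun y => u y 0 j) x.

Lemma partial_one_form_of (R : realType) (u : 'rV[R]_3 -> 'rV[R]_12)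
    (x : 'rV[R]_3) (k j : 'I_3) :
  partial k (fun y => one_form_of (u y) 0 j) x =
  one_form_of (row k (jet u x)) 0 j.
Proof.
rewrite mxE; case: j => -[|[|[|//]]] hj;
  rewrite /= /entry !mxE; congr (partial k _ x);
  by apply/funext => y; rewrite mxE.
Qed.

(** [two_form_of] is linear, so it commutes with differentiation.
    Differentiability is what allows the minus signs below the diagonal to be
    pulled out. *)
Lemma partial_two_form_of (R : realType) (u : 'rV[R]_3 -> 'rV[R]_12)
    (x : 'rV[R]_3) (k i j : 'I_3) :
  (forall m, derivable (fun y => u y 0 m) x (delta_mx 0 k)) ->
  partial k (fun y => two_form_of (u y) i j) x =
  two_form_of (row k (jet u x)) i j.
Proof.
move=> du; rewrite mxE.
have pos m f : (forall y, f y = entry (u y) m) ->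
    partial k f x = entry (row k (jet u x)) m.
  by move=> /funext->; rewrite /entry !mxE.
have neg m f : (forall y, f y = - entry (u y) m) ->
    partial k f x = - entry (row k (jet u x)) m.
  by move=> /funext->; rewrite [LHS](deriveN (du _)) /entry !mxE.
have zero f : (forall y, f y = 0) -> partial k f x = 0.
  by move=> /funext->; exact: derive_cst.
case: i j => -[|[|[|//]]] hi -[[|[|[|//]]] hj] /=;
  [apply: zero | apply: pos | apply: pos | apply: neg | apply: zero
  | apply: pos | apply: neg | apply: neg | apply: zero] => y; by rewrite mxE.
Qed.

(** The terms H_ikl H_j^kl / 2 + 2 F_i^k F_jk of the equation for g, at a
    point where the unknowns have value v and first derivatives p. *)
Definition flow_source {R : realType} (v : 'rV[R]_12) (p : 'M[R]_(3, 12))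
    : 'M[R]_3 :=
  let ginv := invmx (metric_of v) in
  let F i j := one_form_of (row i p) 0 j - one_form_of (row j p) 0 i in
  let H i j k := two_form_of (row i p) j k + two_form_of (row j p) k i
                 + two_form_of (row k p) i j in
  \matrix_(i, j)
    (2^-1 * (\sum_k \sum_l \sum_p \sum_q
               H i k l * (ginv k p * ginv l q * H j p q))
     + 2 * (\sum_k \sum_p (F i p * ginv p k) * F j k)).

(** The second derivatives decouple because F and H, the only terms mixing the
    unknowns, are functions of the first derivatives alone. *)
Lemma flow_operatorE (R : realType) (u : 'rV[R]_3 -> 'rV[R]_12)
    (x : 'rV[R]_3) (i : 'I_12) :
  (forall k m, derivable (fun y => u y 0 m) x (delta_mx 0 k)) ->
  flow_operator u x 0 i =
  trace_hessian (invmx (metric_of (u x))) (fun y => u y 0 i) x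
  + pack (flow_source (u x) (jet u x)) 0 0 0 i.
Proof.
move=> du.
set ginv := invmx _.
rewrite -(pack_componentwise (fun f => trace_hessian ginv f x)) -pack_metricD.
rewrite /flow_operator -/ginv; congr (pack _ _ _ 0 i).
have FE k l : dA (fun y => one_form_of (u y)) x k l =
    one_form_of (row k (jet u x)) 0 l - one_form_of (row l (jet u x)) 0 k.
  by rewrite /dA !partial_one_form_of.
have HE k l m : dB (fun y => two_form_of (u y)) x k l m =
    two_form_of (row k (jet u x)) l m + two_form_of (row l (jet u x)) m k
    + two_form_of (row m (jet u x)) k l.
  by rewrite /dB !partial_two_form_of.
apply/matrixP => k l; rewrite !mxE -addrA; congr (_ + (_ * _ + _ * _)).
  by do 4!apply: eq_bigr => ? _; rewrite !HE.
by do 2!apply: eq_bigr => ? _; rewrite !FE.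
Qed.

Lemma flow_leading_coefficients (R : realType) :
  leading_coefficients (@admissible R) flow_operator flow_symbol.
Proof.
split=> [x v i k j l|].
  by rewrite /flow_symbol -{1}metric_of_sym -trmx_inv mxE.
exists (fun _ v p => pack (flow_source v p) 0 0) => U u oU Cu Du x Ux i.
rewrite (flow_symbol_sum x (u x) i
  (fun k l j => partial k (partial l (fun y => u y 0 j)) x)).
by apply: flow_operatorE => k m; have [_ /(_ k)[/(_ x Ux)]] := Cu m.
Qed.

(** * Uniform ellipticity *)

Theorem lemma2p5 (R : realType) (M : topologicalType)
    (hM : hausdorff_space M) (cM : compact [set: M])
    (C : set (chart R M 3)) (hC : smooth_atlas C)
    (g : chart R M 3 -> 'rV[R]_3 -> 'M[R]_3) (hg : riemannian_metric C g)
    (A : chart R M 3 -> 'rV[R]_3 -> 'rV[R]_3) (hA : one_form C A)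
    (B : chart R M 3 -> 'rV[R]_3 -> 'M[R]_3) (hB : two_form C B) :
  uniformly_elliptic C admissible flow_operator
    (fun e x => pack (g e x) (A e x) (B e x)).
Proof.
exists flow_symbol; first exact: flow_leading_coefficients.
split; first by apply: compact_chart_cover_exists => //; case: hC.
move=> m e K [he _]; have [[gsm _] gmet] := hg.
have bnd (s : 'I_m) (ij : 'I_3 * 'I_3) : exists c : R, 0 <= c /\
    forall p, K s p -> `|g (e s) (coord (e s) p) ij.1 ij.2| <= c.
  have [Ces cK Kd] := he s.
  have cg x : (coord (e s) @` dom (e s)) x ->
      {for x, continuous (fun x => g (e s) x ij.1 ij.2)}.
    by have [+ _] := gsm _ Ces ij.1 ij.2 0; exact.
  by have [c c0 hc] := compact_chart_bounded cK Kd cg; exists c.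
pose b s ij := projT1 (cid (bnd s ij)).
have b0 s ij : 0 <= b s ij by rewrite /b; case: cid => ? [].
have bP s ij p : K s p -> `|g (e s) (coord (e s) p) ij.1 ij.2| <= b s ij.
  by rewrite /b; case: cid => t [t0 ht]; exact: ht.
(* The sum serves as a bound common to all pieces and entries; adding 1 keeps
   it positive when M is empty. *)
pose c := 1 + \sum_s \sum_ij b s ij.
have sb0 s : 0 <= \sum_ij b s ij by apply: sumr_ge0.
have c0 : 0 < c by rewrite ltr_pwDl // sumr_ge0.
have bc s ij : b s ij <= c.
  rewrite /c (bigD1 s) //= (bigD1 ij) //=.
  have : 0 <= \sum_(i | i != s) \sum_ij b i ij by apply: sumr_ge0.
  have : 0 <= \sum_(i | i != ij) b s i by apply: sumr_ge0.
  lra.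
(* The factor 3 is the dimension, from [quad_form_le]. *)
have c30 : 0 < c * 3%:R by rewrite mulr_gt0.
exists (c * 3%:R)^-1; first by rewrite invr_gt0.
move=> s p Kp xi; lazy zeta; set x := coord (e s) p.
have [Ces _ Kd] := he s.
have [gs pg] := gmet _ Ces x (ex_intro2 _ _ p (Kd _ Kp) erefl).
rewrite mulr_sumr; apply: ler_sum => i _.
have -> : \sum_k \sum_j \sum_l
    flow_symbol x (pack (g (e s) x) (A (e s) x) (B (e s) x)) i k j l
      * xi i k * xi j l = (row i xi *m invmx (g (e s) x) *m (row i xi)^T) 0 0.
  rewrite exchange_big /=.
  under eq_bigr do under eq_bigr do under eq_bigr do rewrite -mulrA.
  rewrite (flow_symbol_sum x _ i (fun k l j => xi i k * xi j l)).
  rewrite metric_of_pack // exchange_big /= mxE.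
  apply: eq_bigr => l _; rewrite !mxE mulr_suml; apply: eq_bigr => k _.
  by rewrite !mxE mulrA [_ * xi i k]mulrC.
have -> : \sum_k xi i k ^+ 2 = \sum_k (row i xi) 0 k ^+ 2.
  by apply: eq_bigr => k _; rewrite mxE.
apply: invmx_quad_form_ge => //; apply: quad_form_le => k l.
by apply: le_trans (bc s (k, l)); exact: (bP s (k, l)).
Qed.
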